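(* Let $d>1$ and let $X_1,\dots,X_d$ be non-negative random variables. Let $F$ be the distribution function of $X_1$; assume $\sup\{x:F(x)<1\}=\infty$ and $F\in MDA(\Lambda)$ with auxiliary function $f$. Assume (i) for all $1\le i\ne j\le d$ and all $t>0$, $\lim_{x\to\infty}P(X_j>tf(x)\mid X_i>x)=0$; (ii) for all $1\le i<j\le d$ there exists $L_{ij}>0$ such that $\lim_{x\to\infty}\dfrac{P(X_i>L_{ij}f(x),\,X_j>L_{ij}f(x))}{P(X_i>x)}=0$; (iii) $\lim_{x\to\infty}\dfrac{P(X_i>x)}{P(X_1>x)}=c_i\in(0,\infty)$ for $i=1,2,\dots,d$ (so $c_1=1$). Let $a_1,\dots,a_d\ge0$, not all zero, and define $$\hat S_d=a_1X_1+a_2X_2+\dots+a_dX_d,\qquad m_d=\max_{1\le i\le d}a_i,\qquad N_d=\sum_{\{1\le i\le d:\,a_i=m_d\}}c_i.$$ Then $$P(\hat S_d>x)\sim N_d\,P\Bigl(X_1>\frac{x}{m_d}\Bigr),\qquad x\to\infty.$$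
   Context: $MDA(\Lambda)$ is the maximal domain of attraction of the Gumbel distribution $\Lambda(x)=\exp\{-e^{-x}\}$: the class of distribution functions $F$ for which there exist $\alpha_n>0$, $\beta_n\in\mathbb{R}$ with $\lim_{n\to\infty}n\bar F(\alpha_nx+\beta_n)=e^{-x}$ for all $x\in\mathbb{R}$, where $\bar F=1-F$. When $F$ has infinite right endpoint, $F\in MDA(\Lambda)$ is equivalent to the existence of an auxiliary function $f$: a positive function with derivative converging to $0$ at infinity, self-neglecting (i.e. $\lim_{t\to\infty}f(t+xf(t))/f(t)=1$ for all $x\in\mathbb{R}$), such that $\lim_{t\to\infty}\bar F(t+xf(t))/\bar F(t)=e^{-x}$ for all $x\in\mathbb{R}$. The function $f$ in the claim is such an auxiliary function of $F$, the distribution function of $X_1$. The notation $g(x)\sim h(x)$ means $g(x)/h(x)\to1$. *)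

(* Defs.v *)
From HB Require Import structures.
From mathcomp Require Import all_boot all_order all_algebra.
From mathcomp Require Import all_classical all_reals all_analysis.

Set Implicit Arguments.
Unset Strict Implicit.
Unset Printing Implicit Defensive.

Import Order.TTheory GRing.Theory Num.Theory.
Import numFieldNormedType.Exports.

Local Open Scope classical_set_scope.
Local Open Scope ring_scope.

Definition prob d (T : measurableType d) (R : realType) (P : probability T R)
  (A : set T) : R := fine (P A).

(* Equal to 0 when P B = 0, by the convention x / 0 = 0. *)
Definition cond_prob d (T : measurableType d) (R : realType)
  (P : probability T R) (A B : set T) : R :=
  prob P (A `&` B) / prob P B.

Definition distr_fun d (T : measurableType d) (R : realType)
  (P : probability T R) (X : {RV P >-> R}) (x : R) : R := fine (cdf X x).

Section tails.
Variable R : realType.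
Implicit Types F f g h : R -> R.

Definition tail F (x : R) : R := 1 - F x.

Definition right_endpoint F : \bar R :=
  ereal_sup [set x%:E | x in [set x | F x < 1]].

Definition in_MDA_Gumbel F : Prop :=
  exists (alpha beta : nat -> R),
    (forall n, 0 < alpha n) /\
    forall x, n%:R * tail F (alpha n * x + beta n) @[n --> \oo] --> expR (- x).

Definition self_neglecting f : Prop :=
  forall x, f (t + x * f t) / f t @[t --> +oo] --> (1 : R).

(* Only the behaviour of f near +oo is constrained: auxiliary functions are
   in general defined on a neighbourhood of +oo only (e.g. t |-> t^-1 for the
   normal distribution), and the values of the total function f elsewhere are
   irrelevant. *)
Definition auxiliary_function F f : Prop :=
  [/\ \forall t \near +oo, 0 < f t,
      \forall t \near +oo, derivable f t 1,
      derive1 f t @[t --> +oo] --> (0 : R),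
      self_neglecting f &
      forall x, tail F (t + x * f t) / tail F t @[t --> +oo] --> expR (- x)].

Definition asymp_equiv g h : Prop := g x / h x @[x --> +oo] --> (1 : R).

End tails.

(* Main.v *)
(* Rescale so that the largest weight is 1, and let G be the tail of X_1. As G
   cannot grow by an unbounded factor over a bounded number of steps of length
   f, f(x) = o(x). For the lower bound, the events {X_i > x} with weight 1 have
   pairwise intersections negligible with respect to G(x) by (i), so that the
   Bonferroni inequality applies. For the upper bound, the sum exceeds x only
   if some X_i exceeds x - f(x)/k (weight 1) or x + k f(x) (weight < 1), up to
   two kinds of events which are negligible by (ii) and (i): two of the X_i
   exceed L f(x), or one X_i exceeds x - d L f(x) while another one exceeds
   f(x)/(k d). This gives limsup P(S > x)/G(x) <= N e^(1/k) + C e^(-k) for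
   every k, and k tends to +oo. *)
Require Import Defs.
From mathcomp Require Import all_boot all_order all_algebra.
From mathcomp Require Import all_classical all_reals all_analysis.
From mathcomp Require Import lra.

Set Implicit Arguments.
Unset Strict Implicit.
Unset Printing Implicit Defensive.

Import Order.TTheory GRing.Theory Num.Theory.
Import numFieldNormedType.Exports.

Local Open Scope classical_set_scope.
Local Open Scope ring_scope.

(** * Monotonicity, union bound and Bonferroni bound for real-valued probabilities *)

Lemma prob_ge0 d (T : measurableType d) (R : realType) (P : probability T R)
  (A : set T) : 0 <= prob P A.
Proof. exact: fine_ge0. Qed.

(** The excess of [A] over [B] is a null set. The almost-everywhere form is what the weighted sum
    requires, its summands being non-negative only almost surely. *)
Lemma le_prob_ae d (T : measurableType d) (R : realType) (P : probability T R)
    (A B : set T) : measurable A -> measurable B ->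
  {ae P, forall w, A w -> B w} -> prob P A <= prob P B.
Proof.
move=> mA mB AB; rewrite /prob fine_le ?fin_num_measure//.
have PAB : P (A `\` B) = 0%E.
  apply/negligibleP; first exact: measurableD.
  by apply: negligibleS AB => w [Aw nBw] /= /(_ Aw).
rewrite [leLHS](measureDI P mA mB) [X in (X + _)%E]PAB add0e.
by rewrite le_measure ?inE//; exact: measurableI.
Qed.

Lemma le_prob d (T : measurableType d) (R : realType) (P : probability T R)
    (A B : set T) : measurable A -> measurable B ->
  A `<=` B -> prob P A <= prob P B.
Proof. by move=> mA mB AB; apply: le_prob_ae => //; apply: aeW => w /AB. Qed.

Lemma prob_setU d (T : measurableType d) (R : realType) (P : probability T R)
    (A B : set T) : measurable A -> measurable B ->
  prob P (A `|` B) = prob P A + prob P B - prob P (A `&` B).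
Proof.
move=> mA mB; rewrite /prob measureUfinl ?ltey_eq ?fin_num_measure//.
have mAB := measurableI _ _ mA mB.
by rewrite fineB ?fineD ?fin_numD ?fin_num_measure.
Qed.

Lemma prob_setU_le d (T : measurableType d) (R : realType)
    (P : probability T R) (A B : set T) : measurable A -> measurable B ->
  prob P (A `|` B) <= prob P A + prob P B.
Proof. by move=> mA mB; rewrite prob_setU// gerBl prob_ge0. Qed.

Lemma prob_bigsetU_le d (T : measurableType d) (R : realType)
    (P : probability T R) (I : Type) (r : seq I) (Q : pred I) (A : I -> set T) :
  (forall i, measurable (A i)) ->
  prob P (\big[setU/set0]_(i <- r | Q i) A i) <= \sum_(i <- r | Q i) prob P (A i).
Proof.
move=> mA; elim: r => [|k r IH]; first by rewrite !big_nil /prob measure0.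
rewrite !big_cons; case: (Q k) => //.
apply: le_trans (prob_setU_le P (mA k) _) _; first exact: bigsetU_measurable.
by rewrite lerD2l.
Qed.

(** Bonferroni by induction: a new set [A k] adds its probability minus that of its overlap with the
    previous union, and the union bound controls the overlap. The double sum runs over ordered
    pairs, so each overlap is counted twice; this weaker form suffices when overlaps are
    negligible. *)
Lemma prob_bigsetU_ge d (T : measurableType d) (R : realType)
    (P : probability T R) (I : eqType) (r : seq I) (A : I -> set T) :
  uniq r -> (forall i, measurable (A i)) ->
  \sum_(i <- r) prob P (A i)
    - \sum_(i <- r) \sum_(j <- r | i != j) prob P (A i `&` A j)
  <= prob P (\big[setU/set0]_(i <- r) A i).
Proof.
move=> + mA; elim: r => [|k r IH] /=; first by rewrite !big_nil subr0 prob_ge0.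
move=> /andP[kr /IH {}IH].
have mU := @bigsetU_measurable _ _ _ r xpredT _ (fun i _ => mA i).
rewrite [X in prob _ X]big_cons prob_setU//.
rewrite !big_cons eqxx /=.
set U := \big[setU/set0]_(i <- r) A i in IH mU *.
have capU : prob P (A k `&` U) <= \sum_(j <- r | k != j) prob P (A k `&` A j).
  have -> : \sum_(j <- r | k != j) prob P (A k `&` A j)
      = \sum_(j <- r) prob P (A k `&` A j).
    rewrite big_seq_cond [RHS]big_seq; apply: eq_bigl => j.
    by apply: andb_idr => jr; apply: contraNneq kr => ->.
  rewrite /U setIC big_distrl/= -/U.
  under eq_bigr do rewrite setIC.
  by apply: prob_bigsetU_le => i; exact: measurableI.
suff : \sum_(i <- r) \sum_(j <- r | i != j) prob P (A i `&` A j) <=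
    \sum_(j <- r) \sum_(j0 <- k :: r | j != j0) prob P (A j `&` A j0) by lra.
apply: ler_sum => i _; rewrite big_cons; case: ifP => // _.
by rewrite lerDr prob_ge0.
Qed.

(* If no summand alone nearly reaches [x], the index with the largest [X i]
   is either accompanied by another [X j > L * y], or it exceeds
   [x - d * L * y] while some other [X j] has to make up the missing
   [de * y]. *)
Lemma weighted_sum_gt_cases (R : realType) (d : nat) (i0 : 'I_d)
    (b X : 'I_d -> R) (x y de K L : R) :
  0 < y -> 0 < de -> 0 < L ->
  (forall i, 0 <= b i <= 1) -> (forall i, 0 <= X i) ->
  (forall i, b i != 1 -> b i * (x + K * y) <= x - de * y) ->
  x < \sum_i b i * X i ->
  [\/ exists i, x + (if b i == 1 then - de else K) * y < X i,
      exists i j, [/\ i != j, L * y < X i & L * y < X j] |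
      exists i j, [/\ i != j, x + - (d%:R * L) * y < X i &
                      de / d%:R * y < X j] ].
Proof.
move=> y0 de0 L0 b01 X0 bK xS.
have d0 : (0 : R) < d%:R by rewrite ltr0n; case: d i0 {b X b01 X0 bK xS} => // -[].
have [[i Hi]|nA] := pselect (exists i, x + (if b i == 1 then - de else K) * y < X i).
  by constructor 1; exists i.
(* No index passes its threshold: for weight 1 this is the bound itself, for smaller weights [bK]
   converts it. *)
have bX_le i : b i * X i <= x - de * y.
  have Xi : X i <= x + (if b i == 1 then - de else K) * y.
    by rewrite leNgt; apply/negP => Hi; apply: nA; exists i.
  case: ifPn Xi => [/eqP -> Xi|bi Xi]; first lra.
  apply: le_trans (bK i bi); apply: ler_wpM2l => //.
  by have /andP[] := b01 i.
have bXX i : b i * X i <= X i.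
  by have /andP[bi0 bi1] := b01 i; rewrite ler_piMl.
pose k : 'I_d := [arg max_(i > i0) X i]%O.
have Xk i : X i <= X k by rewrite /k; case: arg_maxP => // j _; apply.
have sum_le (c : R) : 0 <= c -> (forall j, j != k -> X j <= c) ->
    \sum_(j | j != k) b j * X j <= d%:R * c.
  move=> c0 cX; apply: (@le_trans _ _ (\sum_(j : 'I_d) c)).
    rewrite [leRHS](bigD1 k)//= ler_wpDl//.
    by apply: ler_sum => j jk; exact: le_trans (bXX j) (cX j jk).
  by rewrite sumr_const card_ord mulr_natl.
rewrite (bigD1 k)//= in xS.
have [[j [jk Lj]]|nB] := pselect (exists j, j != k /\ L * y < X j).
  by constructor 2; exists k, j; split; rewrite 1?eq_sym//; exact: lt_le_trans (Xk j).
constructor 3.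
have {}nB j : j != k -> X j <= L * y.
  by move=> jk; rewrite leNgt; apply/negP => Lj; apply: nB; exists j.
have Ly0 : 0 <= L * y by rewrite mulr_ge0// ltW.
(* The other summands total at most [d * L * y], which leaves more than [x - d * L * y] for
   [X k]. *)
have := sum_le _ Ly0 nB; rewrite mulrA => sumL.
have [[j [jk Hj]]|nC] := pselect (exists j, j != k /\ de / d%:R * y < X j).
  exists k, j; split => //; first by rewrite eq_sym.
  by have := bXX k; lra.
have {}nC j : j != k -> X j <= de / d%:R * y.
  by move=> jk; rewrite leNgt; apply/negP => Lj; apply: nC; exists j.
(* If all others stay below [de / d * y], they total at most [de * y], too little to lift
   [b k * X k <= x - de * y] above [x]. *)
have Dy0 : 0 <= de / d%:R * y by rewrite mulr_ge0 ?divr_ge0// ltW.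
have := sum_le _ Dy0 nC; rewrite mulrA mulrCA divff ?gt_eqF// mulr1 => sumD.
by have := lt_le_trans xS (lerD (bX_le k) sumD); rewrite subrK ltxx.
Qed.

(** * Limits along the shift [t + x * f t] and quotients of tails *)

(* If [K * f t >= t] for arbitrarily large [t], the ratio
   [G (t - K * f t) / G t >= G 0 / G t] would be unbounded. *)
Lemma auxiliary_scale_small (R : realType) (G f : R -> R) :
  (forall x, 0 < G x) -> {homo G : x y /~ x <= y} ->
  G t @[t --> +oo] --> 0 ->
  (forall x, G (t + x * f t) / G t @[t --> +oo] --> expR (- x)) ->
  forall K, \forall t \near +oo, K * f t < t.
Proof.
move=> G0 Gdec Gto0 Gshift K.
(* [expR K + 1] is a number strictly above the limit [expR K] of the ratio. *)
have e1 : 0 < expR K + 1 by rewrite ltr_pwDl ?expR_gt0.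
near=> t.
have H1 : G (t + - K * f t) / G t < expR K + 1.
  near: t; apply: cvgr_lt (Gshift (- K)) _ _.
  by rewrite opprK ltrDl.
have H2 : G t < G 0 / (expR K + 1).
  by near: t; apply: cvgr_lt Gto0 _ _; exact: divr_gt0.
rewrite ltNge; apply/negP => tK.
have H3 : G 0 <= G (t + - K * f t).
  by apply: Gdec; rewrite mulNr subr_le0.
move: H1; rewrite ltr_pdivrMr// => H1.
move: H2; rewrite ltr_pdivlMr// => H2.
by have := lt_trans (le_lt_trans H3 H1) _; lra.
Unshelve. all: by end_near. Qed.

Lemma shift_cvgy (R : realType) (f : R -> R) :
  (forall K, \forall t \near +oo, K * f t < t) ->
  forall x, t + x * f t @[t --> +oo] --> +oo.
Proof.
move=> fsmall x; apply/cvgryPge => A; near=> t.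
(* This gives [t + x * f t > t / 2 >= A]. *)
have H1 : - 2 * x * f t < t by near: t; exact: fsmall.
have H2 : 2 * A <= t by near: t; apply: nbhs_pinfty_ge; exact: num_real.
lra.
Unshelve. all: by end_near. Qed.

(** Factor the quotient through [G] at the shifted point [t + x * f t], which tends to infinity. *)
Lemma cvg_shift_ratio (R : realType) (G H f : R -> R) (c x : R) :
  (forall x, 0 < G x) ->
  t + x * f t @[t --> +oo] --> +oo ->
  G (t + x * f t) / G t @[t --> +oo] --> expR (- x) ->
  H t / G t @[t --> +oo] --> c ->
  H (t + x * f t) / G t @[t --> +oo] --> c * expR (- x).
Proof.
move=> G0 sy Gx HG.
have HGs : H (t + x * f t) / G (t + x * f t) @[t --> +oo] --> c.
  exact: (cvg_comp _ _ sy HG).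
apply: cvg_trans (cvgM HGs Gx); apply: near_eq_cvg; near=> t.
by rewrite /= mulrA divfK// gt_eqF.
Unshelve. all: by end_near. Qed.

Lemma cvg_ratio0_trans (R : realType) (G H J : R -> R) (c : R) :
  0 < c -> H t / G t @[t --> +oo] --> c ->
  J t / H t @[t --> +oo] --> 0 -> J t / G t @[t --> +oo] --> 0.
Proof.
move=> c0 HG JH; rewrite -[X in _ --> X](mul0r c).
apply: cvg_trans (cvgM JH HG); apply: near_eq_cvg; near=> t.
(* The positive limit [c] forces [H t != 0] eventually; where [H t = 0], the quotient [J t / H t] is
   0 by convention and says nothing about [J t]. *)
have H0 : 0 < H t / G t by near: t; apply: cvgr_gt HG _ _.
rewrite /= mulrA divfK//; apply: contraTneq H0 => ->.
by rewrite mul0r ltxx.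
Unshelve. all: by end_near. Qed.

Lemma cvg0_le (R : realType) (g h : R -> R) :
  (\forall t \near +oo, 0 <= g t) -> (\forall t \near +oo, g t <= h t) ->
  h t @[t --> +oo] --> 0 -> g t @[t --> +oo] --> 0.
Proof.
move=> g0 gh h0; apply: (@squeeze_cvgr _ _ _ _ (fun=> 0) h) => //; last exact: cvg_cst.
by near=> t; apply/andP; split; near: t.
Unshelve. all: by end_near. Qed.

Lemma cvg_sum (R : realType) (I : Type) (r : seq I) (Q : pred I)
    (g : I -> R -> R) (l : I -> R) :
  (forall i, Q i -> g i x @[x --> +oo] --> l i) ->
  \sum_(i <- r | Q i) g i x @[x --> +oo] --> \sum_(i <- r | Q i) l i.
Proof. by move=> gl; apply: cvg_big; first exact: add_continuous. Qed.

Lemma cvg_sum0 (R : realType) (I : Type) (r : seq I) (Q : pred I)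
    (g : I -> R -> R) :
  (forall i, Q i -> g i x @[x --> +oo] --> 0) ->
  \sum_(i <- r | Q i) g i x @[x --> +oo] --> 0.
Proof.
by move=> /cvg_sum g0; have := g0 r; rewrite [in X in _ --> X]big1.
Qed.

(** * Tails of one variable and joint tails of two *)

Section tail_events.
Context d (T : measurableType d) (R : realType) (P : probability T R).

Lemma measurable_gtRV (X : {RV P >-> R}) (x : R) :
  measurable [set w | x < X w].
Proof.
have -> : [set w | x < X w] = X @^-1` `]x, +oo[.
  by apply/seteqP; split => w /=; rewrite in_itv/= andbT.
by rewrite -[_ @^-1` _]setTI; exact: measurable_funP.
Qed.

Lemma prob_gt_dec (X : {RV P >-> R}) :
  {homo (fun x => prob P [set w | x < X w]) : x y /~ x <= y}.
Proof.
move=> x y xy; apply: le_prob; try exact: measurable_gtRV.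
by move=> w /=; exact: le_lt_trans.
Qed.

Lemma tail_distr_fun (X : {RV P >-> R}) :
  tail (distr_fun X) = fun x => prob P [set w | x < X w].
Proof.
apply/funext => x; rewrite /tail /distr_fun /cdf /distribution /pushforward /prob.
have -> : X @^-1` `]-oo, x] = ~` [set w | x < X w].
  by apply/seteqP; split => w /=; rewrite in_itv/= leNgt => /negP.
rewrite probability_setC; last exact: measurable_gtRV.
rewrite fineB ?fin_num_measure//; last exact: measurable_gtRV.
by rewrite /= subKr.
Qed.

Lemma prob_gt_cvg0 (X : {RV P >-> R}) :
  prob P [set w | x < X w] @[x --> +oo] --> 0.
Proof.
rewrite -tail_distr_fun /tail -[X in _ --> X](subrr 1).
apply: cvgB; first exact: cvg_cst.
exact: fine_cvg (cvg_cdfy1 X).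
Qed.

Lemma prob_gt_gt0 (X : {RV P >-> R}) :
  right_endpoint (distr_fun X) = +oo%E ->
  forall x, 0 < prob P [set w | x < X w].
Proof.
move=> endp x.
have : (x%:E < right_endpoint (distr_fun X))%E by rewrite endp ltry.
move=> /ereal_sup_gt[_ [y /= Fy <-]]; rewrite lte_fin => xy.
apply: lt_le_trans (prob_gt_dec X (ltW xy)).
by rewrite -[ltRHS]/((fun y => prob P [set w | y < X w]) y) -tail_distr_fun subr_gt0.
Qed.

(* The self-neglecting property moves the condition [X > t] of the hypothesis
   to [X > t - M * f t] without changing the scale [f t] for [Y]. *)
Lemma joint_shift_negligible (X Y : {RV P >-> R}) (G f : R -> R) (c M eta : R) :
  (forall x, 0 < G x) ->
  (\forall t \near +oo, 0 < f t) ->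
  (forall x, t + x * f t @[t --> +oo] --> +oo) ->
  self_neglecting f ->
  (forall x, G (t + x * f t) / G t @[t --> +oo] --> expR (- x)) ->
  prob P [set w | t < X w] / G t @[t --> +oo] --> c ->
  (forall t, 0 < t ->
     cond_prob P [set w | t * f x < Y w] [set w | x < X w]
       @[x --> +oo] --> (0 : R)) ->
  0 < c -> 0 < eta ->
  prob P ([set w | t + M * f t < X w] `&` [set w | eta * f t < Y w]) / G t
    @[t --> +oo] --> 0.
Proof.
move=> G0 f0 sy sn Gx XG XY c0 eta0.
(* Halving [eta] absorbs the change of scale: eventually [f (t + M * f t) < 2 * f t], so the
   threshold at the shifted point is below [eta * f t]. *)
pose J x := prob P ([set w | eta / 2 * f x < Y w] `&` [set w | x < X w]).
have eta2 : 0 < eta / 2 by rewrite divr_gt0.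
have JG : J t / G t @[t --> +oo] --> 0 by exact: cvg_ratio0_trans XG (XY _ eta2).
have := cvg_shift_ratio G0 (sy M) (Gx M) JG.
rewrite mul0r; apply: cvg0_le.
  by near=> t; rewrite divr_ge0 ?prob_ge0// ltW.
near=> t.
have ft0 : 0 < f t by near: t.
have f2 : f (t + M * f t) / f t < 2.
  by near: t; apply: cvgr_lt (sn M) _ _; rewrite ltr1n.
rewrite ltr_pdivrMr// in f2.
rewrite ler_pM2r ?invr_gt0// /J.
apply: le_prob; try by apply: measurableI; exact: measurable_gtRV.
move=> w /= [Xw Yw]; split => //; apply: le_lt_trans Yw.
by rewrite mulrAC -mulrA ler_pM2l//; lra.
Unshelve. all: by end_near. Qed.

End tail_events.

(** * Lower and upper bounds for the tail of a sum with weights in [0, 1] *)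

Section weighted_sum.
Context disp (T : measurableType disp) (R : realType) (P : probability T R).
Context (d : nat) (X : 'I_d -> {RV P >-> R}) (G f : R -> R) (c b : 'I_d -> R).

Let S (x : R) : R := prob P [set w | x < \sum_(i < d) b i * X i w].

Lemma measurable_weighted_sum_gt x :
  measurable [set w | x < \sum_(i < d) b i * X i w].
Proof.
have -> : [set w | x < \sum_(i < d) b i * X i w] =
    [set: T] `&` (fun w => \sum_(i < d) b i * X i w) @^-1` `]x, +oo[.
  by rewrite setTI; apply/seteqP; split => w /=; rewrite in_itv/= andbT.
by apply: measurable_sum => // i; exact: measurable_realfun.measurable_funM.
Qed.

Lemma weighted_sum_tail_ge (e : R) :
  (forall i, \forall w \ae P, 0 <= X i w) ->
  (forall x, 0 < G x) ->
  (\forall t \near +oo, f t < t) ->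
  (forall i, 0 < c i) ->
  (forall i, prob P [set w | t < X i w] / G t @[t --> +oo] --> c i) ->
  (forall i j, i != j -> forall t : R, 0 < t ->
     cond_prob P [set w | t * f x < X j w] [set w | x < X i w]
       @[x --> +oo] --> (0 : R)) ->
  (forall i, 0 <= b i <= 1) ->
  0 < e ->
  \forall x \near +oo, \sum_(i < d | b i == 1) c i - e < S x / G x.
Proof.
move=> X0 G0 fsmall c0 XG XY b01 e0.
pose r := [seq i <- index_enum 'I_d | b i == 1].
have ur : uniq r by rewrite filter_uniq// index_enum_uniq.
have pair0 i j : i != j ->
    prob P ([set w | x < X i w] `&` [set w | x < X j w]) / G x
      @[x --> +oo] --> 0.
  move=> ij.
  (* With [t := 1]: eventually [f x < x], so [X j > x] implies [X j > 1 * f x]. *)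
  have := cvg_ratio0_trans (c0 i) (XG i) (XY i j ij 1 ltr01); apply: cvg0_le.
    by near=> t; rewrite divr_ge0 ?prob_ge0// ltW.
  near=> t; rewrite ler_pM2r ?invr_gt0//.
  apply: le_prob; try by apply: measurableI; exact: measurable_gtRV.
  move=> w /= [Xi Xj]; split => //; apply: lt_trans Xj; rewrite mul1r.
  by near: t.
have lim : \sum_(i <- r) prob P [set w | x < X i w] / G x
    - \sum_(i <- r) \sum_(j <- r | i != j)
        prob P ([set w | x < X i w] `&` [set w | x < X j w]) / G x
    @[x --> +oo] --> \sum_(i < d | b i == 1) c i.
  rewrite -[X in _ --> X]subr0; apply: cvgB.
    by rewrite -big_filter; apply: cvg_sum => i _; exact: XG.
  by apply: cvg_sum0 => i _; apply: cvg_sum0 => j ij; exact: pair0.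
near=> x.
apply: (@lt_le_trans _ _ (\sum_(i <- r) prob P [set w | x < X i w] / G x
    - \sum_(i <- r) \sum_(j <- r | i != j)
        prob P ([set w | x < X i w] `&` [set w | x < X j w]) / G x)).
  by near: x; apply: cvgr_gt lim _ _; rewrite gtrBl.
under [X in _ - X]eq_bigr do rewrite -mulr_suml.
rewrite -!mulr_suml -mulrBl ler_pM2r ?invr_gt0//.
have mA i : measurable [set w | x < X i w] by exact: measurable_gtRV.
apply: le_trans (prob_bigsetU_ge P ur mA) _.
apply: le_prob_ae.
- exact: bigsetU_measurable.
- exact: measurable_weighted_sum_gt.
have X0' : \forall w \ae P, forall i, 0 <= X i w by exact: filter_forall.
(* When all variables are non-negative, one summand of weight 1 above [x] already lifts the sum
   above [x]. *)
apply: filterS X0' => w Xw.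
rewrite -bigcup_seq => -[i /=]; rewrite mem_filter => /andP[/eqP bi _] xX.
apply: lt_le_trans xX _; rewrite (bigD1 i)//= bi mul1r lerDl.
apply: sumr_ge0 => j _; rewrite mulr_ge0//.
by have /andP[] := b01 j.
Unshelve. all: by end_near. Qed.

Lemma weighted_sum_tail_le (e : R) (i0 : 'I_d) :
  (forall i, \forall w \ae P, 0 <= X i w) ->
  (forall x, 0 < G x) ->
  (\forall t \near +oo, 0 < f t) ->
  (forall K, \forall t \near +oo, K * f t < t) ->
  self_neglecting f ->
  (forall x, G (t + x * f t) / G t @[t --> +oo] --> expR (- x)) ->
  (forall i, 0 < c i) ->
  (forall i, prob P [set w | t < X i w] / G t @[t --> +oo] --> c i) ->
  (forall i j, i != j -> forall t : R, 0 < t ->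
     cond_prob P [set w | t * f x < X j w] [set w | x < X i w]
       @[x --> +oo] --> (0 : R)) ->
  (forall i j, i != j -> exists2 L : R, 0 < L &
     prob P ([set w | L * f x < X i w] `&` [set w | L * f x < X j w])
       / G x @[x --> +oo] --> (0 : R)) ->
  (forall i, 0 <= b i <= 1) ->
  0 < e ->
  \forall x \near +oo, S x / G x < \sum_(i < d | b i == 1) c i + e.
Proof.
move=> X0 G0 f0 fsmall sn Gx c0 XG XY XX b01 e0.
have d0 : (0 : R) < d%:R by rewrite ltr0n; case: d i0 => // -[].
have sy := shift_cvgy fsmall.
(* One [L] for all pairs: the sum of the individual constants dominates each of them, and raising
   [L] shrinks the events. Diagonal pairs receive a dummy constant 1. *)
have [L L0 XL] : exists2 L : R, 0 < L & forall i j, i != j ->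
    prob P ([set w | L * f x < X i w] `&` [set w | L * f x < X j w])
      / G x @[x --> +oo] --> (0 : R).
  have /choice[L_ HL] (p : 'I_d * 'I_d) : exists L : R, 0 < L /\ (p.1 != p.2 ->
      prob P ([set w | L * f x < X p.1 w] `&` [set w | L * f x < X p.2 w])
       / G x @[x --> +oo] --> (0 : R)).
    have [E|N] := eqVneq p.1 p.2; first by exists 1.
    by have [L L0 HL] := XX _ _ N; exists L.
  exists (\sum_p L_ p).
    rewrite (bigD1 (i0, i0))//= ltr_pwDl//; first by have [] := HL (i0, i0).
    by apply: sumr_ge0 => p _; have [/ltW] := HL p.
  move=> i j ij; have [Lij0 /(_ ij)] := HL (i, j); apply: cvg0_le.
    by near=> t; rewrite divr_ge0 ?prob_ge0// ltW.
  near=> t.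
  have ft0 : 0 < f t by near: t.
  have LL : L_ (i, j) * f t <= (\sum_p L_ p) * f t.
    rewrite ler_pM2r// (bigD1 (i, j))//= lerDl.
    by apply: sumr_ge0 => p _; have [/ltW] := HL p.
  rewrite ler_pM2r ?invr_gt0//.
  apply: le_prob; try by apply: measurableI; exact: measurable_gtRV.
  by move=> w /= [Xi Xj]; split; exact: le_lt_trans LL _.
(* Shifts of the thresholds, in units of [f x]. As [k] grows, [expR (- s k i)] tends to 1 for weight
   1 and to 0 otherwise, so [k] can be fixed before [x] tends to infinity. *)
pose s (k : R) i := if b i == 1 then - k^-1 else k.
have [k k0 Hk] : exists2 k : R, 0 < k &
    \sum_i c i * expR (- s k i) < \sum_(i < d | b i == 1) c i + e.
  have lim : \sum_i c i * expR (- s k i) @[k --> +oo] --> \sum_(i < d | b i == 1) c i.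
    rewrite [X in _ --> X]big_mkcond/=; apply: cvg_sum => i _.
    rewrite /s; case: ifP => _.
      have kV : (- - k^-1 : R) @[k --> +oo] --> - - (0 : R).
        apply: cvgN; apply: cvgN; apply/gtr0_cvgV0; last exact: cvg_id.
        exact: nbhs_pinfty_gt.
      rewrite !oppr0 in kV; rewrite -[X in _ --> X]mulr1 -expR0.
      apply: cvgM; first exact: cvg_cst.
       exact: (cvg_comp _ _ kV (@continuous_expR R 0)).
    rewrite -[X in _ --> X](mulr0 (c i)); by apply: cvgM; [exact: cvg_cst|exact: cvgr_expR].
  near +oo_R => k; exists k; first by near: k; exact: nbhs_pinfty_gt.
  by near: k; apply: cvgr_lt lim _ _; rewrite ltrDl.
have k'0 : 0 < k^-1 by rewrite invr_gt0.
pose A (x : R) i := [set w | x + s k i * f x < X i w].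
pose B (x : R) (p : 'I_d * 'I_d) := [set w | L * f x < X p.1 w] `&` [set w | L * f x < X p.2 w].
pose C (x : R) (p : 'I_d * 'I_d) := [set w | x + - (d%:R * L) * f x < X p.1 w]
  `&` [set w | k^-1 / d%:R * f x < X p.2 w].
pose U (x : R) : R := \sum_i prob P (A x i) + \sum_(p | p.1 != p.2) prob P (B x p)
   + \sum_(p | p.1 != p.2) prob P (C x p).
(* Only the single exceedances [A] contribute to the limit; the pair events [B] and [C] vanish. *)
have Ulim : U x / G x @[x --> +oo] --> \sum_i c i * expR (- s k i).
  have AL : \sum_i prob P (A x i) / G x @[x --> +oo] --> \sum_i c i * expR (- s k i).
    by apply: cvg_sum => i _; exact: (cvg_shift_ratio G0 (sy _) (Gx _) (XG i)).
  have BL : \sum_(p | p.1 != p.2) prob P (B x p) / G x @[x --> +oo] --> 0.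
    by apply: cvg_sum0 => p pp; exact: XL.
  have CL : \sum_(p | p.1 != p.2) prob P (C x p) / G x @[x --> +oo] --> 0.
    apply: cvg_sum0 => p pp.
    have XYp := XY _ _ pp; have kd : 0 < k^-1 / d%:R by rewrite divr_gt0.
    exact: (joint_shift_negligible (- (d%:R * L)) G0 f0 sy sn Gx (XG p.1) XYp).
  rewrite -[X in _ --> X]addr0 -[X in _ --> X]addr0.
  apply: cvg_trans (cvgD (cvgD AL BL) CL); apply: near_eq_cvg; near=> x.
  by rewrite /U !mulrDl !mulr_suml.
have mA x i : measurable (A x i) by exact: measurable_gtRV.
have mB x p : measurable (B x p) by apply: measurableI; exact: measurable_gtRV.
have mC x p : measurable (C x p) by apply: measurableI; exact: measurable_gtRV.
have bsmall i : \forall x \near +oo, b i != 1 ->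
    b i * (x + k * f x) <= x - k^-1 * f x.
  have [->|bi] := eqVneq (b i) 1; first exact: nearW.
  have /andP[bi0 bi1] := b01 i.
  have bi2 : 0 < 1 - b i by rewrite subr_gt0 lt_neqAle bi.
  near=> x => _.
  (* The desired inequality solved for [x]; the coefficient of [f x] is finite because [b i < 1], so
     [f x = o(x)] applies. *)
  have : (b i * k + k^-1) / (1 - b i) * f x < x by near: x; exact: fsmall.
  rewrite mulrAC ltr_pdivrMr// => ?; lra.
near=> x.
have fx0 : 0 < f x by near: x.
have Ux : U x / G x < \sum_(i < d | b i == 1) c i + e.
  by near: x; apply: cvgr_lt Ulim _ _.
apply: le_lt_trans Ux; rewrite ler_pM2r ?invr_gt0// /S /U.
have bx : forall i, b i != 1 -> b i * (x + k * f x) <= x - k^-1 * f x.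
  by near: x; apply: filter_forall => i; exact: bsmall.
have mUA : measurable (\big[setU/set0]_i A x i) by exact: bigsetU_measurable.
have mUB : measurable (\big[setU/set0]_(p | p.1 != p.2) B x p) by exact: bigsetU_measurable.
have mUC : measurable (\big[setU/set0]_(p | p.1 != p.2) C x p) by exact: bigsetU_measurable.
apply: (@le_trans _ _ (prob P (\big[setU/set0]_i A x i
    `|` \big[setU/set0]_(p | p.1 != p.2) B x p
    `|` \big[setU/set0]_(p | p.1 != p.2) C x p))); last first.
  apply: le_trans (prob_setU_le P _ mUC) _; first exact: measurableU.
  apply: lerD; last exact: prob_bigsetU_le.
  apply: le_trans (prob_setU_le P mUA mUB) _.
  by apply: lerD; exact: prob_bigsetU_le.
apply: le_prob_ae.
- exact: measurable_weighted_sum_gt.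
- by apply: measurableU => //; exact: measurableU.
have X0' : \forall w \ae P, forall i, 0 <= X i w by exact: filter_forall.
apply: filterS X0' => w Xw xS.
rewrite -!bigcup_seq_cond.
have [[i Hi]|[i [j [ij Hi Hj]]]|[i [j [ij Hi Hj]]]] :=
  weighted_sum_gt_cases i0 fx0 k'0 L0 b01 Xw bx xS.
- by left; left; exists i => //=; rewrite mem_index_enum.
- by left; right; exists (i, j) => //=; rewrite mem_index_enum.
- by right; exists (i, j) => //=; rewrite mem_index_enum.
Unshelve. all: by end_near. Qed.

End weighted_sum.

(** * Reduction to maximal weight 1 and change of scale *)

Theorem corollary4p3
  (R : realType) (disp : measure_display) (T : measurableType disp)
  (P : probability T R) (d : nat) (hd : (1 < d)%N)
  (X : 'I_d -> {RV P >-> R})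
  (X_ge0 : forall i : 'I_d, \forall w \ae P, 0 <= X i w)
  (f : R -> R) (c a : 'I_d -> R) :
  let i1 : 'I_d := Ordinal (ltnW hd) in
  let F : R -> R := distr_fun (X i1) in
  right_endpoint F = +oo%E ->
  in_MDA_Gumbel F ->
  auxiliary_function F f ->
  (forall i j : 'I_d, i != j -> forall t : R, 0 < t ->
     cond_prob P [set w | t * f x < X j w] [set w | x < X i w]
       @[x --> +oo] --> (0 : R)) ->
  (forall i j : 'I_d, (i < j)%N -> exists2 L : R, 0 < L &
     prob P ([set w | L * f x < X i w] `&` [set w | L * f x < X j w])
       / prob P [set w | x < X i w] @[x --> +oo] --> (0 : R)) ->
  (forall i : 'I_d, 0 < c i /\
     prob P [set w | x < X i w] / prob P [set w | x < X i1 w]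
       @[x --> +oo] --> c i) ->
  (forall i : 'I_d, 0 <= a i) ->
  (exists i : 'I_d, a i != 0) ->
  (* the a i are nonnegative, so taking 0 as the default value of the maximum
     does not change it *)
  let m : R := \big[Num.max/0]_(i < d) a i in
  let N : R := \sum_(i < d | a i == m) c i in
  asymp_equiv (fun x => prob P [set w | x < \sum_(i < d) a i * X i w])
              (fun x => N * prob P [set w | x / m < X i1 w]).
Proof.
move=> i1 F endp _ [f0 _ _ sn tailF] XY XX cX a0 [i0 ai0] m N.
pose G x := prob P [set w | x < X i1 w].
have G0 : forall x, 0 < G x := prob_gt_gt0 endp.
rewrite /F tail_distr_fun in tailF.
have fsmall := auxiliary_scale_small G0 (prob_gt_dec (X i1)) (prob_gt_cvg0 (X i1)) tailF.
have f1 : \forall t \near +oo, f t < t.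
  by apply: filterS (fsmall 1) => t; rewrite mul1r.
have c0 i : 0 < c i by have [] := cX i.
have XG i : prob P [set w | t < X i w] / G t @[t --> +oo] --> c i by have [] := cX i.
have am i : a i <= m by exact: le_bigmax.
have m0 : 0 < m by apply: lt_le_trans (am i0); rewrite lt_neqAle eq_sym ai0 a0.
pose b i := a i / m.
have b01 i : 0 <= b i <= 1.
  by rewrite divr_ge0 ?(ltW m0)//= ler_pdivrMr// mul1r.
have NE : N = \sum_(i < d | b i == 1) c i.
  apply: eq_bigl => i; rewrite -[RHS](inj_eq (mulIf (lt0r_neq0 m0))) mul1r.
  by rewrite divfK // gt_eqF.
(* The maximum is attained despite its default 0, as the weights are non-negative; hence the sum
   defining [N] is non-empty and [N] positive. *)
have [im aim] : exists i, a i = m.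
  have [i _ Hi] := eq_bigmax i0 xpredT a erefl (fun i _ => a0 i).
  by exists i.
have N0 : 0 < N.
  rewrite /N (bigD1 im)/= ?aim// ltr_pwDl//.
  by apply: sumr_ge0 => i _; exact: ltW.
have XX' i j : i != j -> exists2 L : R, 0 < L &
    prob P ([set w | L * f x < X i w] `&` [set w | L * f x < X j w])
      / G x @[x --> +oo] --> (0 : R).
  wlog ij : i j / (i < j)%N => [Hw|_].
    rewrite neq_ltn => /orP[] ij; first by apply: Hw => //; rewrite neq_ltn ij.
    have [|L L0 HL] := Hw _ _ ij; first by rewrite neq_ltn ij.
    by exists L => //; under eq_cvg do rewrite setIC.
  (* The normalisation by the tail of [X i] is exchanged for [G], the two being comparable with
     ratio [c i]. *)
  have [L L0 HL] := XX _ _ ij; exists L => //.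
  exact: cvg_ratio0_trans (XG i) HL.
have lim : prob P [set w | y < \sum_(i < d) b i * X i w] / G y @[y --> +oo] --> N.
  apply/cvgrPdist_lt => e e0; near=> y.
  rewrite ltr_distlC NE; apply/andP; split; near: y.
    exact: (weighted_sum_tail_ge X_ge0 G0 f1 c0 XG XY b01 e0).
    exact: (weighted_sum_tail_le i0 X_ge0 G0 f0 fsmall sn tailF c0 XG XY XX' b01 e0).
have scale : x / m @[x --> +oo] --> +oo.
  by apply: gt0_cvgMly; [rewrite invr_gt0|exact: cvg_id].
rewrite /asymp_equiv -[X in _ --> X](divff (lt0r_neq0 N0)).
(* Substitute [y = x / m] in [lim] and divide by [N]; the sum with weights [b] exceeds [x / m]
   exactly when the one with weights [a] exceeds [x]. *)
apply: cvg_trans (cvgM (cvg_comp _ _ scale lim) (cvg_cst N^-1)).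
apply: near_eq_cvg; near=> x; rewrite /= invfM mulrA mulrAC; congr (prob P _ / _ / _).
apply/funext => w; rewrite /mkset ltr_pdivrMr// mulr_suml.
congr (is_true (x < _)); apply: eq_bigr => i _.
by rewrite mulrAC divfK// gt_eqF.
Unshelve. all: by end_near. Qed.
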